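(* For every $v\equiv 0,6,12 \pmod{24}$ with $v\ge 12$, there exists a $2$-split decomposition of $K_v^{(3)}-I$ into tight $6$-cycles.
   Context: $K_v^{(3)}$ denotes the complete $3$-uniform hypergraph on $v$ vertices; for $3\mid v$, $K_v^{(3)}-I$ is obtained by deleting the edges of a $1$-factor $I$ (a set of $v/3$ pairwise disjoint triples covering all vertices). A (3-uniform tight) $k$-cycle is given by a cyclic sequence $v_1,\dots,v_k$ of $k$ distinct vertices, its edges being the triples $\{v_i,v_{i+1},v_{i+2}\}$ ($i=1,\dots,k$, indices mod $k$). A decomposition is a collection of cycles whose edge sets partition the edge set. For even $v$ with $3\mid v/2$, a $2$-split decomposition of $K_v^{(3)}-I$ into $k$-cycles is one where the vertex set is partitioned into two sets $V_1,V_2$ of size $v/2$, the $1$-factor is $I=I_1\cup I_2$ with $I_j$ a $1$-factor of $V_j$, and the collection of cycles consists of a $k$-cycle decomposition of $K^{(3)}[V_1]-I_1$, a $k$-cycle decomposition of $K^{(3)}[V_2]-I_2$, and a $k$-cycle decomposition of the hypergraph of all triples meeting both $V_1$ and $V_2$. *)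

(* Defs.v *)
From mathcomp Require Import all_boot.
Set Implicit Arguments. Unset Strict Implicit. Unset Printing Implicit Defensive.

Section Hyper.
Variable T : finType.

Definition complete3 (V : {set T}) : {set {set T}} :=
  [set e : {set T} | (e \subset V) && (#|e| == 3)].

Definition crossing3 (V1 V2 : {set T}) : {set {set T}} :=
  [set e : {set T} | [&& #|e| == 3, e :&: V1 != set0 & e :&: V2 != set0]].

Definition one_factor (V : {set T}) (F : {set {set T}}) : bool :=
  partition F V && [forall B in F, #|B| == 3].

(* A k-cycle is given by a cyclic sequence c(0),...,c(k-1) of distinct vertices;
   its edges are {c i, c (i+1), c (i+2)}, indices mod k. *)
Definition cycle_edge (k : nat) (c : {ffun 'I_k -> T}) (i : 'I_k) : {set T} :=
  [set c i; c (ordS i); c (ordS (ordS i))].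

Definition cycle_edges (k : nat) (c : {ffun 'I_k -> T}) : seq {set T} :=
  [seq cycle_edge c i | i <- enum 'I_k].

Definition kcycle_decomposition (k : nat) (H : {set {set T}})
    (cs : seq {ffun 'I_k -> T}) : Prop :=
  all (fun c : {ffun 'I_k -> T} => injectiveb (fun i => c i)) cs /\
  perm_eq (flatten [seq cycle_edges c | c <- cs]) (enum H).

End Hyper.

Definition two_split_decomposition (v k : nat) : Prop :=
  exists (V1 : {set 'I_v}) (I1 I2 : {set {set 'I_v}})
         (cs1 cs2 cs3 : seq {ffun 'I_k -> 'I_v}),
    let V2 := ~: V1 in
    [/\ #|V1| = v %/ 2, #|V2| = v %/ 2,
         one_factor V1 I1 & one_factor V2 I2] /\
    [/\ kcycle_decomposition (complete3 V1 :\: I1) cs1,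
         kcycle_decomposition (complete3 V2 :\: I2) cs2 &
         kcycle_decomposition (crossing3 V1 V2) cs3].

(* Main.v *)
Require Import Defs.
From mathcomp Require Import all_boot zify.
Set Implicit Arguments. Unset Strict Implicit. Unset Printing Implicit Defensive.

(** Write v = 6m and split the vertices into 2m groups of size 3, m on each side; I is the
    set of groups. A triple e is classified by the set of groups that it meets.
    - The 18 triples that meet exactly two given groups form K_6 minus a 1-factor, which is
      the union of three 6-cycles.
    - The triples that meet exactly three given groups form K_{3,3,3}, with an odd number (27)
      of edges; but for two 3-sets of groups that share two groups they form K_{3,3,6}, the
      union of three copies of K_{3,3,2}, each of which is the union of three 6-cycles.
    So it is enough to pair off the 3-sets of groups into 3-sets that share two groups.
    On one side, with m = 0, 1, 2 mod 4, this is done by adding four groups w, x, y, z at a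
    time: abw~abx, aby~abz, and for each old a the six pairs from {w, x, y, z} are matched
    along adjacent edges of K_4, as are the four triples inside {w, x, y, z}. For crossing
    3-sets abc with c on the other side, pair the c's if m is even, and the edges ab of K_m
    if m = 1 mod 4. *)

(** * Lists of triples that split into tight 6-cycles *)

Definition decomposable (T : finType) (L : seq {set T}) : Prop :=
  exists cs : seq {ffun 'I_6 -> T},
    all (fun c : {ffun 'I_6 -> T} => injectiveb (fun i => c i)) cs /\
    perm_eq (flatten [seq cycle_edges c | c <- cs]) L.

Section Decomposable.
Variable T : finType.
Implicit Types L : seq {set T}.

Lemma decomposable_nil : decomposable (Nil {set T}).
Proof. by exists [::]. Qed.

Lemma decomposable_cat L1 L2 :
  decomposable L1 -> decomposable L2 -> decomposable (L1 ++ L2).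
Proof.
move=> [c1 [i1 p1]] [c2 [i2 p2]]; exists (c1 ++ c2).
by rewrite all_cat i1 i2 map_cat flatten_cat perm_cat.
Qed.

Lemma decomposable_perm L1 L2 :
  perm_eq L1 L2 -> decomposable L1 -> decomposable L2.
Proof. by move=> p12 [c [ic pc]]; exists c; split=> //; apply: perm_trans p12. Qed.

End Decomposable.

(** * Coding of vertices and triples by numbers *)

Section Codes.
Variables (T : finType) (N : nat) (x : nat -> T).
Hypothesis x_inj : {in gtn N &, injective x}.

Definition triple_set (t : nat * nat * nat) : {set T} :=
  [set x t.1.1; x t.1.2; x t.2].

Definition sort3 (a b c : nat) : nat * nat * nat :=
  if a < b then if b < c then (a, b, c) else if a < c then (a, c, b) else (c, a, b)
  else if a < c then (b, a, c) else if b < c then (b, c, a) else (c, b, a).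

(* Vertices are coded by numbers below [N] so that perm_eq of edge lists can be computed. *)
Definition code_edges (c : seq nat) : seq (nat * nat * nat) :=
  [seq sort3 (nth 0 c i) (nth 0 c (i.+1 %% 6)) (nth 0 c ((i.+1 %% 6).+1 %% 6))
     | i <- iota 0 6].

Definition is_code (c : seq nat) : bool :=
  [&& uniq c, size c == 6 & all (gtn N) c].

Lemma triple_set_sort3 a b c : triple_set (sort3 a b c) = [set x a; x b; x c].
Proof.
rewrite /sort3; repeat case: ltnP => ?; apply/setP=> y; rewrite !inE /=;
  by case: (y == x a); case: (y == x b); case: (y == x c).
Qed.

Lemma cycle_edges_code c :
  cycle_edges [ffun i : 'I_6 => x (nth 0 c i)] = map triple_set (code_edges c).
Proof.
rewrite -map_comp -val_enum_ord -map_comp; apply: eq_map => i /=.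
by rewrite triple_set_sort3 /cycle_edge !ffunE.
Qed.

(** Leaves two boolean checks on numbers, decided by computation once [cs] and [L] are concrete. *)
Lemma decomposable_code cs L :
  all is_code cs -> perm_eq (flatten (map code_edges cs)) L ->
  decomposable (map triple_set L).
Proof.
move=> /allP csP /(perm_map triple_set) pL.
exists [seq [ffun i : 'I_6 => x (nth 0 c i)] | c : seq nat <- cs]; split.
  rewrite all_map; apply/allP=> c /csP /and3P[uc /eqP sc /allP cN] /=.
  have cI (k : 'I_6) : nth 0 c k \in gtn N.
    by have := cN (nth 0 c k); rewrite mem_nth ?sc //; apply.
  apply/injectiveP=> i j; rewrite !ffunE => /(x_inj (cI i) (cI j))/eqP.
  by rewrite nth_uniq ?sc // => /eqP /val_inj.
rewrite -map_comp; apply: perm_trans pL; rewrite map_flatten -map_comp.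
by rewrite (eq_map (cycle_edges_code : _ =1 map triple_set \o code_edges)).
Qed.

(* Normal form of the code of a triple, which makes [triple_set] injective. *)
Definition increasing3 (t : nat * nat * nat) : bool := t.1.1 < t.1.2 < t.2.

Lemma triple_set_inj t t' :
  increasing3 t -> increasing3 t' -> t.2 < N -> t'.2 < N ->
  triple_set t = triple_set t' -> t = t'.
Proof.
case: t t' => [[a b] c] [[a' b'] c']; rewrite /increasing3 /triple_set /=.
move=> i1 i2 cN c'N /setP eqS.
have xE p q : p < N -> q < N -> (x p == x q) = (p == q).
  by move=> pN qN; apply/eqP/eqP=> [/x_inj->|->].
have inE_ p : p < N -> (p == a) || (p == b) || (p == c)
             = (p == a') || (p == b') || (p == c').
  by move=> pN; have := eqS (x p); rewrite !inE !xE //; lia.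
(* Equal sets have the same minimum and the same maximum; the middle element is then the only one
   left. *)
have le1 : a' <= a by have := inE_ a; lia.
have le2 : a <= a' by have := inE_ a'; lia.
have le3 : c <= c' by have := inE_ c; lia.
have le4 : c' <= c by have := inE_ c'; lia.
have ea : a = a' by lia.
have ec : c = c' by lia.
have eb : b = b' by have := inE_ b; lia.
by rewrite ea eb ec.
Qed.

Lemma triple_setP (e : {set T}) :
  #|e| = 3 -> (forall y, y \in e -> exists2 a, a < N & y = x a) ->
  exists t, [/\ increasing3 t, t.2 < N & e = triple_set t].
Proof.
move=> e3 eN.
have [s [us ss es]] : exists s, [/\ uniq s, size s = 3 & e = [set:: s]].
  by exists (enum e); rewrite enum_uniq -cardE e3 set_enum.
case: s us ss es => [|y1 [|y2 [|y3 []]]] //= us _ es.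
have [|a aN ya] := eN y1; first by rewrite es !inE eqxx.
have [|b bN yb] := eN y2; first by rewrite es !inE eqxx orbT.
have [|c cN yc] := eN y3; first by rewrite es !inE eqxx !orbT.
exists (sort3 a b c); rewrite triple_set_sort3; split; last first.
- by rewrite es ya yb yc; apply/setP=> z; rewrite !inE orbA.
- by rewrite /sort3; case: (ltnP a b); case: (ltnP b c); case: (ltnP a c).
have neq p q : x p != x q -> p != q by apply: contraNneq => ->.
move: us; rewrite ya yb yc !inE => /and3P[/norP[/neq ab /neq ac] /neq bc _].
by rewrite /increasing3 /sort3; case: (ltnP a b); case: (ltnP b c); case: (ltnP a c) => /=; lia.
Qed.

End Codes.

Definition increasing_triples (N : nat) : seq (nat * nat * nat) :=
  [seq t <- [seq (p, c) | p <- [seq (a, b) | a <- iota 0 N, b <- iota 0 N], c <- iota 0 N]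
     | increasing3 t].

Lemma mem_increasing_triples N t :
  (t \in increasing_triples N) = increasing3 t && (t.2 < N).
Proof.
case: t => [[a b] c]; rewrite mem_filter; case: (boolP (increasing3 _)) => //= abc.
apply/allpairsP/idP => [[[p c'] [/= _]]|cN]; first by rewrite mem_iota => cN [_ ->].
by exists ((a, b), c); rewrite /= mem_iota allpairs_f // mem_iota;
  move: abc; rewrite /increasing3 /=; lia.
Qed.

Lemma increasing_triples_uniq N : uniq (increasing_triples N).
Proof.
apply: filter_uniq; apply: allpairs_uniq; rewrite ?iota_uniq //.
  by apply: allpairs_uniq; rewrite ?iota_uniq // => -[? ?] [? ?] _ _ [-> ->].
by move=> -[? ?] [? ?] _ _ [-> ->].
Qed.

(** * Groups of three points, and the triples over a set of groups *)

Section Groups.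
Variables (T G : finType) (coord : T -> G * 'I_3) (vertex : G * 'I_3 -> T).
Hypotheses (coordK : cancel coord vertex) (vertexK : cancel vertex coord).

Definition group_of (x : T) : G := (coord x).1.

Definition triples_over (s : {set G}) : {set {set T}} :=
  [set e : {set T} | (#|e| == 3) && (group_of @: e == s)].

(** A list with multiplicities, so that partial results can be concatenated and rearranged up to
    [perm_eq]. *)
Definition liftable (L : seq {set G}) : Prop :=
  decomposable (flatten [seq enum (triples_over s) | s <- L]).

Lemma liftable_nil : liftable [::].
Proof. exact: decomposable_nil. Qed.

Lemma liftable_cat L1 L2 : liftable L1 -> liftable L2 -> liftable (L1 ++ L2).
Proof. by rewrite /liftable map_cat flatten_cat; apply: decomposable_cat. Qed.

Lemma liftable_perm L1 L2 : perm_eq L1 L2 -> liftable L1 -> liftable L2.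
Proof.
by move=> p12; apply: decomposable_perm; apply: perm_flatten; apply: perm_map.
Qed.

Lemma liftable_flatten (A : eqType) (r : seq A) (F : A -> seq {set G}) :
  {in r, forall a, liftable (F a)} -> liftable (flatten (map F r)).
Proof.
elim: r => [|a r IH] rP; first exact: liftable_nil.
by apply: liftable_cat; [apply: rP; rewrite inE eqxx|
  apply: IH => b br; apply: rP; rewrite inE br orbT].
Qed.

Lemma liftable_seq L : {in L, forall s, liftable [:: s]} -> liftable L.
Proof. by move/liftable_flatten; rewrite flatten_seq1. Qed.

Lemma liftable_map2 (A : eqType) (r : seq A) (f h : A -> {set G}) :
  {in r, forall a, liftable [:: f a; h a]} -> liftable (map f r ++ map h r).
Proof.
move/liftable_flatten; apply: liftable_perm; apply/permP=> p.
elim: r => //= a r; rewrite !count_cat /=; lia.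
Qed.

(** Each triple lies over exactly one set of groups, its image under [group_of], so the lists for
    different members of [P] do not overlap. *)
Lemma enum_triples_over (P : {set {set G}}) :
  perm_eq (enum [set e : {set T} | (#|e| == 3) && (group_of @: e \in P)])
    (flatten [seq enum (triples_over s) | s <- enum P]).
Proof.
apply: uniq_perm; rewrite ?enum_uniq //.
  have /= := @allpairs_uniq_dep _ (fun=> {set T}) _ (fun _ e => e) (enum P)
    (fun s => enum (triples_over s)).
  rewrite (eq_map (fun s => map_id (enum (triples_over s)))); apply.
  - exact: enum_uniq.
  - by move=> s _; apply: enum_uniq.
  move=> [s e] [s' e'] /allpairsPdep /= [s1 [e1 [_]]].
  rewrite mem_enum inE => /andP[_ /eqP <-] [-> ->].
  move=> /allpairsPdep /= [s2 [e2 [_]]].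
  by rewrite mem_enum inE => /andP[_ /eqP <-] [-> ->] ->.
move=> e; rewrite mem_enum inE; apply/andP/flatten_mapP => [[e3 eP]|[s]].
  by exists (group_of @: e); rewrite mem_enum // inE e3 eqxx.
by rewrite !mem_enum inE => sP /andP[-> /eqP->].
Qed.

(* The group [nth i0 gs k] consists of the points number 3k, 3k+1 and 3k+2. *)
Definition point (gs : seq G) (i0 : G) (a : nat) : T :=
  vertex (nth i0 gs (a %/ 3), inord (a %% 3)).

Lemma point_inj gs i0 : uniq gs -> {in gtn (3 * size gs) &, injective (point gs i0)}.
Proof.
move=> ugs a b aN bN /(can_inj vertexK) [/eqP].
have aN' : a < 3 * size gs by exact: aN.
have bN' : b < 3 * size gs by exact: bN.
rewrite nth_uniq ?ltn_divLR ?[_ * 3]mulnC // => /eqP dab /(congr1 val).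
by rewrite /= !inordK ?ltn_mod // => mab; rewrite (divn_eq a 3) dab mab -divn_eq.
Qed.

Lemma group_of_point gs i0 a : group_of (point gs i0 a) = nth i0 gs (a %/ 3).
Proof. by rewrite /group_of vertexK. Qed.

Lemma point_surj gs i0 y :
  group_of y \in gs -> exists2 a, a < 3 * size gs & y = point gs i0 a.
Proof.
move=> ygs; exists (3 * index (group_of y) gs + (coord y).2).
  by have := ltn_ord (coord y).2; have := ygs; rewrite -index_mem; lia.
have lt3 := ltn_ord (coord y).2.
rewrite /point [3 * _]mulnC divnMDl // divn_small // addn0 nth_index //.
by rewrite modnMDl modn_small // inord_val /group_of -surjective_pairing coordK.
Qed.

(** Turns the triples over given sets of groups into a concrete list: the arithmetic test [K] on
    codes replaces [Q], and since [Q] admits only sets within [gs], every triple wanted has a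
    code. *)
Lemma enum_triples_code gs i0 (K : pred (nat * nat * nat)) (Q : pred {set G}) :
  uniq gs -> (forall s i, Q s -> i \in s -> i \in gs) ->
  (forall a b c, a < b -> b < c -> c < 3 * size gs -> K (a, b, c) =
     Q [set nth i0 gs (a %/ 3); nth i0 gs (b %/ 3); nth i0 gs (c %/ 3)]) ->
  perm_eq [seq triple_set (point gs i0) t
             | t <- [seq t <- increasing_triples (3 * size gs) | K t]]
    (enum [set e : {set T} | (#|e| == 3) && Q (group_of @: e)]).
Proof.
move=> ugs Qgs KQ; have pinj := @point_inj gs i0 ugs.
have imE t : group_of @: triple_set (point gs i0) t =
  [set nth i0 gs (t.1.1 %/ 3); nth i0 gs (t.1.2 %/ 3); nth i0 gs (t.2 %/ 3)].
  by rewrite /triple_set !imsetU !imset_set1 !group_of_point.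
apply: uniq_perm; rewrite ?enum_uniq //.
  rewrite map_inj_in_uniq => [|t t']; first exact/filter_uniq/increasing_triples_uniq.
  rewrite mem_filter mem_increasing_triples => /and3P[_ it tN].
  rewrite mem_filter mem_increasing_triples => /and3P[_ it' tN'].
  exact: (triple_set_inj pinj).
move=> e; rewrite mem_enum inE; apply/mapP/andP => [[t]|[/eqP e3 Qe]].
  rewrite mem_filter mem_increasing_triples => /and3P[Kt it tN] ->.
  rewrite imE; case: t => [[a b] c] in Kt it tN *; move: it => /andP[/= ab bc].
  rewrite -KQ ?Kt //; split=> //; rewrite /triple_set /=.
  have neq p q : p < q -> q < 3 * size gs -> (point gs i0 p == point gs i0 q) = false.
    move=> pq qN; apply/eqP=> /(pinj _ _ (ltn_trans pq qN) qN) pqE.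
    by rewrite pqE ltnn in pq.
  by rewrite -setUA cardsU1 cards2 !inE !neq // ?(ltn_trans ab bc) ?(ltn_trans bc tN).
have [|t [it tN eE]] := triple_setP (N := 3 * size gs) (x := point gs i0) e3.
  by move=> y ye; apply: point_surj; apply: (Qgs _ _ Qe); apply: imset_f.
exists t => //; rewrite mem_filter mem_increasing_triples it tN andbT.
move: Qe; rewrite eE imE; case: t it tN {eE} => [[a b] c] /andP[/= ab bc] cN.
by rewrite -KQ // => ->.
Qed.

(** * The two building blocks, settled by explicit cycles *)

Lemma liftable_pair i j : i != j -> liftable [:: [set i; j]].
Proof.
move=> nij; rewrite /liftable /= cats0.
have ugs : uniq [:: i; j] by rewrite /= inE nij.
pose K (t : nat * nat * nat) := (t.1.1 < 3) && (3 <= t.2).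
apply: (@decomposable_perm _ [seq triple_set (point [:: i; j] i) t
   | t <- [seq t <- increasing_triples 6 | K t]]).
  apply: (enum_triples_code (gs := [:: i; j]) (i0 := i) (Q := pred1 [set i; j])) => //.
    by move=> s k /eqP->; rewrite !inE.
  move=> a b c ab bc; rewrite /K /= => cN.
  (* Everything depends only on the quotients by 3, the positions of the groups in the list, so
     finitely many cases remain. *)
  have [a2 b2 c2] : [/\ a %/ 3 < 2, b %/ 3 < 2 & c %/ 3 < 2] by split; lia.
  have -> : (a < 3) = (a %/ 3 == 0) by lia.
  have -> : (3 <= c) = (c %/ 3 == 1) by lia.
  have {ab bc cN} : a %/ 3 <= b %/ 3 <= c %/ 3 by rewrite (leq_div2r _ (ltnW ab)) (leq_div2r _ (ltnW bc)).
  move: (a %/ 3) (b %/ 3) (c %/ 3) a2 b2 c2 => [|[]] // [|[]] // [|[]] //= _ _ _ _.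
  - by rewrite !setUid; apply/esym/eqP=> /setP/(_ j); rewrite !inE eqxx orbT eq_sym (negPf nij).
  - by rewrite setUid !eqxx.
  - by rewrite -setUA setUid !eqxx.
  - by rewrite !setUid; apply/esym/eqP=> /setP/(_ i); rewrite !inE eqxx (negPf nij).
(* Three cycles covering all triples on six points except 012 and 345. *)
apply: (@decomposable_code _ 6 _ (@point_inj [:: i; j] i ugs)
  [:: [:: 0; 1; 5; 2; 3; 4]; [:: 0; 2; 5; 4; 1; 3]; [:: 0; 4; 2; 1; 3; 5]]).
  by vm_compute.
by vm_compute.
Qed.

Lemma liftable_adjacent i j k l :
  uniq [:: i; j; k; l] -> liftable [:: [set i; j; k]; [set i; j; l]].
Proof.
move=> ugs; have := ugs; rewrite /= !inE !negb_or => /and4P[/and3P[ij ik il] /andP[jk jl] kl _].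
rewrite /liftable.
(* Codes 6 to 11 run through [k] and [l] together, so [K] describes K_{3,3,6}. *)
pose K (t : nat * nat * nat) := [&& t.1.1 < 3, 3 <= t.1.2, t.1.2 < 6 & 6 <= t.2].
pose Q := pred2 [set i; j; k] [set i; j; l].
have neqs : [set i; j; k] != [set i; j; l].
  by apply/eqP=> /setP/(_ k); rewrite !inE eqxx orbT ![k == _]eq_sym (negPf ik) (negPf jk) eq_sym (negPf kl).
apply: (@decomposable_perm _ [seq triple_set (point [:: i; j; k; l] i) t
   | t <- [seq t <- increasing_triples 12 | K t]]).
  apply: (@perm_trans _ (enum [set e : {set T} | (#|e| == 3) && Q (group_of @: e)])).
    apply: enum_triples_code => //.
      by move=> s k' /orP[]/eqP->; rewrite !inE; do ![case/orP]=> ->; rewrite ?orbT.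
    move=> a b c ab bc; rewrite /K /= => cN.
    have [a4 b4 c4] : [/\ a %/ 3 < 4, b %/ 3 < 4 & c %/ 3 < 4] by split; lia.
    have -> : (a < 3) = (a %/ 3 == 0) by lia.
    have -> : (3 <= b) = (0 < b %/ 3) by lia.
    have -> : (b < 6) = (b %/ 3 < 2) by lia.
    have -> : (6 <= c) = (1 < c %/ 3) by lia.
    have {ab bc cN} : a %/ 3 <= b %/ 3 <= c %/ 3 by rewrite (leq_div2r _ (ltnW ab)) (leq_div2r _ (ltnW bc)).
    (* The next three facts are necessary conditions for [Q] that refute every case in which it
       should fail. *)
    have Qi x y z : Q [set x; y; z] -> i \in [set x; y; z].
      by case/orP=> /eqP->; rewrite !inE eqxx.
    have Qj x y z : Q [set x; y; z] -> j \in [set x; y; z].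
      by case/orP=> /eqP->; rewrite !inE eqxx ?orbT.
    have Qkl x y z : Q [set x; y; z] -> (k \in [set x; y; z]) || (l \in [set x; y; z]).
      by case/orP=> /eqP->; rewrite !inE eqxx ?orbT.
    move: (a %/ 3) (b %/ 3) (c %/ 3) a4 b4 c4.
    move=> [|[|[|[]]]] // [|[|[|[]]]] // [|[|[|[]]]] //= _ _ _ _;
      try (by rewrite /Q /= eqxx ?orbT); apply/esym/negP => q;
      have := Qi _ _ _ q; have := Qj _ _ _ q; have := Qkl _ _ _ q; rewrite !inE ?eqxx;
      by rewrite ?[k == i]eq_sym ?[k == j]eq_sym ?[l == i]eq_sym ?[l == j]eq_sym ?[j == i]eq_sym
       ?(negPf ij) ?(negPf ik) ?(negPf il) ?(negPf jk) ?(negPf jl).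
  have -> : [set e : {set T} | (#|e| == 3) && Q (group_of @: e)] =
      [set e : {set T} | (#|e| == 3) && (group_of @: e \in [set [set i; j; k]; [set i; j; l]])].
    by apply/setP=> e; rewrite !inE.
  apply: (perm_trans (enum_triples_over _)); apply/perm_flatten/perm_map.
  apply: uniq_perm; rewrite ?enum_uniq //= ?inE ?neqs //.
  by move=> s; rewrite mem_enum !inE.
(* Each row covers one K_{3,3,2}, with last part {6,7}, {8,9} or {10,11}; the rows differ only in
   this part, and {8,9} has one point in each of [k] and [l]. *)
apply: (@decomposable_code _ 12 _ (@point_inj [:: i; j; k; l] i ugs)
  [:: [:: 0; 3; 7; 2; 4; 6]; [:: 1; 3; 6; 2; 5; 7]; [:: 0; 5; 6; 1; 4; 7];
      [:: 0; 3; 9; 2; 4; 8]; [:: 1; 3; 8; 2; 5; 9]; [:: 0; 5; 8; 1; 4; 9];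
      [:: 0; 3; 11; 2; 4; 10]; [:: 1; 3; 10; 2; 5; 11]; [:: 0; 5; 10; 1; 4; 11]]).
  by vm_compute.
by vm_compute.
Qed.

(** Coordinate-free form of [liftable_adjacent], the single move behind all the pairings below. *)
Lemma liftable_swap (e : {set G}) x y :
  #|e| = 2 -> x \notin e -> y \notin e -> x != y -> liftable [:: x |: e; y |: e].
Proof.
move=> /eqP/cards2P[i [j [ij ->]]]; rewrite !inE !negb_or => /andP[xi xj] /andP[yi yj] xy.
rewrite ![_ |: [set i; j]]setUC; apply: liftable_adjacent.
by rewrite /= !inE !negb_or ij ![i == _]eq_sym ![j == _]eq_sym xi xj yi yj xy.
Qed.

(** * Matching pairs and 3-sets of groups, four new groups at a time *)

Definition ksubsets (k : nat) (S : {set G}) : {set {set G}} :=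
  [set e : {set G} | (e \subset S) && (#|e| == k)].

(** Pascal's rule for lists; applied four times, it produces the blocks that the inductions below
    match. *)
Lemma ksubsetsS k x (S : {set G}) : x \notin S ->
  perm_eq (enum (ksubsets k.+1 (x |: S)))
    (enum (ksubsets k.+1 S) ++ [seq x |: e | e <- enum (ksubsets k S)]).
Proof.
move=> xS; have xE e : e \in ksubsets k S -> x \notin e.
  by rewrite inE => /andP[/subsetP eS _]; apply: contra xS; apply: eS.
apply: uniq_perm; rewrite ?enum_uniq //.
  rewrite cat_uniq enum_uniq map_inj_in_uniq ?enum_uniq ?andbT => [|e e'].
    apply/hasPn => _ /mapP[e _ ->]; rewrite mem_enum inE; apply/negP=> /andP[/subsetP sub _].
    by move/negP: xS; apply; apply: sub; rewrite !inE eqxx.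
  rewrite !mem_enum => /xE xe /xE xe' eqU.
  by rewrite -(setU1K xe) eqU setU1K.
move=> e; rewrite mem_cat !mem_enum !inE; apply/andP/orP=> [[esub /eqP ek]|[|]].
- case: (boolP (x \in e)) => xe; [right|left].
    apply/mapP; exists (e :\ x); last by rewrite setD1K.
    by rewrite mem_enum inE subDset esub -eqSS -ek (cardsD1 x e) xe add1n eqxx.
  by rewrite ek eqxx andbT -(setU1K xS) subsetD1 esub xe.
- by case/andP=> eS ->; rewrite (subset_trans eS) // subsetUr.
case/mapP=> f; rewrite mem_enum => fk ->; have := xE _ fk; move: fk.
by rewrite inE => /andP[fS /eqP fk] xf; rewrite setUS // cardsU1 xf fk.
Qed.

Lemma ksubsets0 (S : {set G}) : perm_eq (enum (ksubsets 0 S)) [:: set0].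
Proof.
apply: uniq_perm; rewrite ?enum_uniq // => e.
rewrite mem_enum !inE cards_eq0; case: eqP => [->|]; by rewrite ?sub0set ?andbF.
Qed.

Lemma enum_ksubsets_small k (S : {set G}) : #|S| < k -> enum (ksubsets k S) = [::].
Proof.
move=> Sk; suff -> : ksubsets k S = set0 by rewrite enum_set0.
apply/setP=> e; rewrite !inE; apply/andP=> -[/subset_leq_card le /eqP ek].
by move: le; rewrite ek leqNgt Sk.
Qed.

Lemma ksubsetsP k (S e : {set G}) :
  e \in enum (ksubsets k S) -> #|e| = k /\ forall x, x \notin S -> x \notin e.
Proof.
rewrite mem_enum inE => /andP[/subsetP eS /eqP->]; split=> // x xS.
by apply: contra xS; apply: eS.
Qed.

(** Removing four elements keeps the cardinality modulo 4, so residue conditions pass through the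
    induction. *)
Lemma set_ind4 (P : {set G} -> Prop) :
  (forall S : {set G}, #|S| < 4 -> P S) ->
  (forall (S : {set G}) w x y z,
     [/\ w \notin x |: (y |: (z |: S)), x \notin y |: (z |: S),
         y \notin z |: S & z \notin S] ->
     P S -> P (w |: (x |: (y |: (z |: S))))) ->
  forall S, P S.
Proof.
move=> P0 PS S; have [n] := ubnP #|S|; elim: n S => // n IH S Sn.
have [|S4] := ltnP #|S| 4; first exact: P0.
have [S0|[w wS]] := set_0Vmem S; first by rewrite S0 cards0 in S4.
have := cardsD1 w S; rewrite wS => cw.
have [S0|[x xS]] := set_0Vmem (S :\ w); first by rewrite S0 cards0 in cw; lia.
have := cardsD1 x (S :\ w); rewrite xS => cx.
have [S0|[y yS]] := set_0Vmem (S :\ w :\ x); first by rewrite S0 cards0 in cx; lia.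
have := cardsD1 y (S :\ w :\ x); rewrite yS => cy.
have [S0|[z zS]] := set_0Vmem (S :\ w :\ x :\ y); first by rewrite S0 cards0 in cy; lia.
have := cardsD1 z (S :\ w :\ x :\ y); rewrite zS => cz.
rewrite -(setD1K wS) -(setD1K xS) -(setD1K yS) -(setD1K zS).
apply: PS; last by apply: IH; lia.
by rewrite !setD1K // !inE !eqxx.
Qed.

Lemma card_setU4 (S : {set G}) w x y z :
  [/\ w \notin x |: (y |: (z |: S)), x \notin y |: (z |: S),
         y \notin z |: S & z \notin S] ->
  #|w |: (x |: (y |: (z |: S)))| = #|S| + 4.
Proof. by case=> hw hx hy hz; rewrite !cardsU1 hw hx hy hz; lia. Qed.

(** The edges of the complete graph on [S] are matched into adjacent pairs. Their number is even
    exactly for residues 0 and 1 modulo 4, and in the base case there are none. *)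
Lemma liftable_cone (c : G) (S : {set G}) : c \notin S -> #|S| %% 4 < 2 ->
  liftable [seq c |: e | e <- enum (ksubsets 2 S)].
Proof.
elim/set_ind4: S => [S S4 _ S2|S w x y z nS IH cS].
  by rewrite enum_ksubsets_small; [apply: liftable_nil | lia].
rewrite (card_setU4 nS) modnDr => /IH {}IH; case: nS => hw hx hy hz.
move: (hw) (hx) (hy); rewrite !in_setU1 !negb_or.
move=> /and4P[wx wy wz wS] /and3P[xy xz xS] /andP[yz yS].
move: cS; rewrite !in_setU1 !negb_or => /and5P[cw cx cy cz cS].
have {}IH := IH cS.
set X := fun (a : G) (L : seq {set G}) => [seq a |: e | e <- L].
set S2 := enum (ksubsets 2 S); set S1 := enum (ksubsets 1 S).
set S0 := [:: set0 : {set G}].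
(* Two new vertices joined to the same old one; the common pair is [c] with the old vertex. *)
have two a b e : a \notin S -> b \notin S -> a != b -> c != a -> c != b -> e \in S1 ->
    liftable [:: c |: (a |: e); c |: (b |: e)].
  move=> aS bS ab ca cb /ksubsetsP[e1 nS]; rewrite ![c |: (_ |: e)]setUCA.
  apply: liftable_swap; rewrite ?cardsU1 ?e1 ?nS // in_setU1 negb_or nS // andbT eq_sym //.
have L1 : liftable (X c (X z S1) ++ X c (X y S1)).
  by rewrite /X -!map_comp; apply: liftable_map2 => e eS; apply: two; rewrite // eq_sym.
have L2 : liftable (X c (X x S1) ++ X c (X w S1)).
  by rewrite /X -!map_comp; apply: liftable_map2 => e eS; apply: two; rewrite // eq_sym.
have three a b d : [/\ a != b, a != d & b != d] -> [/\ c != a, c != b & c != d] ->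
    liftable [:: c |: (a |: (d |: set0)); c |: (b |: (d |: set0))].
  move=> [ab ad bd] [ca cb cd]; rewrite ![c |: (_ |: (_ |: _))]setUCA setU0.
  by apply: liftable_swap; rewrite // ?cards2 ?cd // !inE negb_or eq_sym ?ca ?cb ?ad ?bd.
(* The six edges of K_4 on the new vertices form three paths: yz~xz, xy~wy, wz~wx. *)
have L3 : liftable (X c (X y (X z S0)) ++ X c (X x (X z S0))) by apply: three; split; rewrite // eq_sym.
have L4 : liftable (X c (X x (X y S0)) ++ X c (X w (X y S0))) by apply: three; split; rewrite // eq_sym.
have L5 : liftable (X c (X w (X z S0)) ++ X c (X w (X x S0))).
  rewrite /X /= ![w |: (_ |: set0)]setUCA; apply: three => //.
  by split; rewrite // eq_sym.
have := liftable_cat IH (liftable_cat L1 (liftable_cat L2 (liftable_cat L3 (liftable_cat L4 L5)))).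
(* Lists are compared by counting: Pascal's rule expands both sides into the same terms, which are
   then abstracted to numbers for [lia]. *)
apply: liftable_perm; apply/permP=> p; rewrite /X.
rewrite !(count_map, count_cat, permP (ksubsetsS _ hw), permP (ksubsetsS _ hx),
  permP (ksubsetsS _ hy), permP (ksubsetsS _ hz), permP (ksubsets0 _)) -/S1 -/S2 -/S0.
repeat match goal with |- context [count ?q ?s] => let n := fresh "n" in set n := (count q s); move: n end; clear; lia.
Qed.

(** The number of 3-subsets is even exactly when the residue is not 3; below four elements this
    leaves at most two, hence no 3-subset. *)
Lemma liftable_ksubsets3 (S : {set G}) :
  #|S| %% 4 < 3 -> liftable (enum (ksubsets 3 S)).
Proof.
elim/set_ind4: S => [S S4 S3|S w x y z nS IH].
  by rewrite enum_ksubsets_small; [apply: liftable_nil | lia].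
rewrite (card_setU4 nS) modnDr => /IH {}IH; case: nS => hw hx hy hz.
move: (hw) (hx) (hy); rewrite !in_setU1 !negb_or.
move=> /and4P[wx wy wz wS] /and3P[xy xz xS] /andP[yz yS].
set X := fun (a : G) (L : seq {set G}) => [seq a |: e | e <- L].
set S2 := enum (ksubsets 2 S); set S1 := enum (ksubsets 1 S).
set S0 := [:: set0 : {set G}].
(* [one] matches new elements over an old pair, [two] pairs of new elements over an old one, [three]
   triples of new elements. *)
have one a b : a \notin S -> b \notin S -> a != b -> liftable (X a S2 ++ X b S2).
  by move=> aS bS ab; apply: liftable_map2 => e /ksubsetsP[e2 nS]; apply: liftable_swap; rewrite ?nS.
have two a b d e : [/\ a \notin S, b \notin S & d \notin S] ->
    [/\ a != b, a != d & b != d] -> e \in S1 -> liftable [:: a |: (d |: e); b |: (d |: e)].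
  move=> [aS bS dS] [ab ad bd] /ksubsetsP[e1 nS].
  by apply: liftable_swap; rewrite ?cardsU1 ?e1 ?nS // in_setU1 negb_or nS // andbT.
(* For each old element, the same three paths of K_4 as for the cone. *)
have L1 : liftable (X y (X z S1) ++ X x (X z S1)).
  by rewrite /X -!map_comp; apply: liftable_map2 => e eS; apply: two => //; split; rewrite // eq_sym.
have L2 : liftable (X x (X y S1) ++ X w (X y S1)).
  by rewrite /X -!map_comp; apply: liftable_map2 => e eS; apply: two => //; split; rewrite // eq_sym.
have L3 : liftable (X w (X z S1) ++ X w (X x S1)).
  rewrite /X -!map_comp; apply: liftable_map2 => e eS /=.
  by rewrite (setUCA [set w] [set z]) (setUCA [set w] [set x]); apply: two => //; split; rewrite // eq_sym.
have three a b d f : uniq [:: a; b; d; f] ->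
    liftable [:: a |: (d |: (f |: set0)); b |: (d |: (f |: set0))].
  rewrite /= !inE !negb_or setU0 => /and4P[/and3P[ab ad af] /andP[bd bf] df _].
  by apply: liftable_swap; rewrite ?cards2 ?df // !inE negb_or ?ad ?bd.
(* The four new triples: xyz~wyz, and then wxz~wxy. *)
have L4 : liftable (X x (X y (X z S0)) ++ X w (X y (X z S0))).
  by apply: three; rewrite /= !inE !negb_or ![x == w]eq_sym wx xy xz wy wz yz.
have L5 : liftable (X w (X x (X z S0)) ++ X w (X x (X y S0))).
  rewrite /X /= (setUCA [set x] [set z]) (setUCA [set x] [set y]) (setUCA [set w] [set z])
    (setUCA [set w] [set y]); apply: three.
  by rewrite /= !inE !negb_or eq_sym yz ![_ == w]eq_sym wz wy wx ![_ == x]eq_sym xz xy.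
have := liftable_cat IH (liftable_cat (one z y hz yS _) (liftable_cat (one x w xS wS _)
  (liftable_cat L1 (liftable_cat L2 (liftable_cat L3 (liftable_cat L4 L5)))))).
rewrite eq_sym yz eq_sym wx => /(_ isT isT).
apply: liftable_perm; apply/permP=> p; rewrite /X.
rewrite !(count_map, count_cat, permP (ksubsetsS _ hw), permP (ksubsetsS _ hx),
  permP (ksubsetsS _ hy), permP (ksubsetsS _ hz), permP (ksubsets0 _)) -/S1 -/S2 -/S0.
repeat match goal with |- context [count ?q ?s] => let n := fresh "n" in set n := (count q s); move: n end; clear; lia.
Qed.

(** * Crossing 3-sets of groups *)

Lemma liftable_even_cone (r : seq G) (L : seq {set G}) :
  uniq r -> ~~ odd (size r) ->
  (forall e, e \in L -> #|e| = 2 /\ forall c, c \in r -> c \notin e) ->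
  liftable (flatten [seq [seq c |: e | e <- L] | c <- r]).
Proof.
have [n] := ubnP (size r); elim: n r => // n IH [|c [|d r]] //= rn ur ro LP.
  exact: liftable_nil.
move: ur; rewrite !inE negb_or => /and3P[/andP[cd cr] dr ur].
(* Two apexes at a time: [c] and [d] are matched over the same pair [e]. *)
rewrite catA; apply: liftable_cat.
  apply: liftable_map2 => e /LP[e2 ne].
  by apply: liftable_swap; rewrite ?ne // !inE eqxx ?orbT.
apply: IH => //; first by lia.
  by rewrite -[odd _]negbK.
by move=> e /LP[e2 ne]; split=> // b br; apply: ne; rewrite !inE br !orbT.
Qed.

Lemma enum_setU_disjoint (A B : {set {set G}}) :
  [disjoint A & B] -> perm_eq (enum (A :|: B)) (enum A ++ enum B).
Proof.
move=> dAB; apply: uniq_perm; rewrite ?enum_uniq //.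
  rewrite cat_uniq !enum_uniq andbT; apply/hasPn=> s; rewrite !mem_enum => sB.
  by rewrite (disjointFl dAB).
by move=> s; rewrite mem_cat !mem_enum inE.
Qed.

Definition two_one (S1 S2 : {set G}) : {set {set G}} :=
  [set s : {set G} | (#|s :&: S1| == 2) && (#|s :&: S2| == 1)].

(** The pair [e] and the apex [c] are recovered from their union as its traces on [S] and on the
    complement. *)
Lemma enum_two_one (S : {set G}) :
  perm_eq (enum (two_one S (~: S)))
    (flatten [seq [seq c |: e | e <- enum (ksubsets 2 S)] | c <- enum (~: S)]).
Proof.
have coneI c e : c \in ~: S -> e \in ksubsets 2 S ->
    ((c |: e) :&: S = e) * ((c |: e) :&: ~: S = [set c]).
  rewrite !inE => cS /andP[eS _]; split; apply/setP=> a; rewrite !inE.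
    case: eqP => [->|_] /=; first by rewrite (negPf cS); apply/esym/negP=> /(subsetP eS); apply/negP.
    by case: (boolP (a \in e)) => // /(subsetP eS) ->.
  case: eqP => [->|_] /=; first by rewrite cS.
  by case: (boolP (a \in e)) => // /(subsetP eS) ->.
apply: uniq_perm; rewrite ?enum_uniq //.
  apply: allpairs_uniq; rewrite ?enum_uniq // => -[c e] [c' e'].
  move=> /allpairsP [[? ?] /= [+ + [-> ->]]] /allpairsP [[? ?] /= [+ + [-> ->]]] eqs.
  rewrite !mem_enum => cS eS cS' eS'; congr (_, _).
    by apply: set1_inj; rewrite -(coneI _ _ cS eS).2 eqs (coneI _ _ cS' eS').2.
  by rewrite -(coneI _ _ cS eS).1 eqs (coneI _ _ cS' eS').1.
move=> s; rewrite mem_enum inE; apply/andP/allpairsP => [[s2 /cards1P[c sc]]|].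
  exists (c, s :&: S); rewrite !mem_enum /= -sc; split.
  - have : c \in s :&: ~: S by rewrite sc set11.
    by rewrite in_setI => /andP[].
  - by rewrite inE subsetIr.
  - by rewrite setUC -setIUr setUCr setIT.
move=> [[c e] /= []]; rewrite !mem_enum => cS eS ->.
by rewrite (coneI _ _ cS eS).1 (coneI _ _ cS eS).2 cards1; move: eS; rewrite inE => /andP[_ ->].
Qed.

Lemma liftable_two_one (S : {set G}) :
  #|S| = #|~: S| -> #|S| %% 4 < 3 -> liftable (enum (two_one S (~: S))).
Proof.
move=> cS S3; have := enum_two_one S; rewrite perm_sym => /liftable_perm; apply.
have [oS|eS] := boolP (odd #|S|); last first.
  apply: liftable_even_cone; rewrite ?enum_uniq -?cardE -?cS //.
  by move=> e /ksubsetsP[e2 nS]; split=> // c; rewrite mem_enum inE => /nS.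
(* An odd size with residue below 3 has residue 1, so the pairs in [S] can be matched for each apex
   separately. *)
apply: liftable_flatten => c; rewrite mem_enum inE => cnS; apply: liftable_cone => //.
by move: S3 oS; rewrite (divn_eq #|S| 4) modnMDl modn_mod oddD oddM andbF /=; case: (_ %% 4) => [|[|[]]].
Qed.

Lemma liftable_ksubsets2 (S : {set G}) : liftable (enum (ksubsets 2 S)).
Proof.
apply: liftable_seq => s; rewrite mem_enum inE => /andP[_ /cards2P[i [j [ij ->]]]].
exact: liftable_pair.
Qed.

(** * Return to triples of points: the sides and the crossing triples *)

Lemma decomposition_exists (H : {set {set T}}) (P : {set {set G}}) :
  H = [set e : {set T} | (#|e| == 3) && (group_of @: e \in P)] ->
  liftable (enum P) -> exists cs : seq {ffun 'I_6 -> T}, kcycle_decomposition H cs.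
Proof.
move=> -> decP; have [cs [ics pcs]] := decP; exists cs; split=> //.
by rewrite (permPl pcs) perm_sym enum_triples_over.
Qed.

Lemma card_fiber i : #|group_of @^-1: [set i]| = 3.
Proof.
have -> : group_of @^-1: [set i] = [set vertex (i, a) | a : 'I_3].
  apply/setP=> y; rewrite !inE; apply/eqP/imsetP => [<-|[a _ ->]].
    by exists (coord y).2; rewrite // -surjective_pairing coordK.
  by rewrite /group_of vertexK.
by rewrite card_imset ?card_ord // => a b /(can_inj vertexK) [].
Qed.

Section Side.
Variable S : {set G}.
Let V := group_of @^-1: S.
Let F := [set group_of @^-1: [set i] | i in S].

Lemma fibers_one_factor : one_factor V F.
Proof.
apply/andP; split; last first.
  by apply/forallP=> B; apply/implyP=> /imsetP[i _ ->]; rewrite card_fiber.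
apply/and3P; split.
- apply/eqP/setP=> y; apply/bigcupP/idP => [[_ /imsetP[i iS ->]]|].
    by rewrite !inE => /eqP->.
  by rewrite inE => yS; exists (group_of @^-1: [set group_of y]); rewrite ?imset_f // !inE.
- apply/trivIsetP=> _ _ /imsetP[i _ ->] /imsetP[j _ ->] nij.
  rewrite -setI_eq0; apply/eqP/setP=> y; rewrite !inE; apply/andP=> -[/eqP yi /eqP yj].
  by rewrite -yi -yj eqxx in nij.
by apply/imsetP=> -[i _ /(congr1 (fun A : {set T} => #|A|))]; rewrite card_fiber cards0.
Qed.

(** A triple that meets only one group is that group, since both have three points; deleting [F]
    thus leaves the triples that meet two or three groups. *)
Lemma complete_minus_fibersE : complete3 V :\: F =
  [set e : {set T} | (#|e| == 3) && (group_of @: e \in ksubsets 2 S :|: ksubsets 3 S)].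
Proof.
apply/setP=> e; rewrite !inE [in RHS]andbC -andb_orr sub_imset_pre.
case: eqP => [e3|_]; last by rewrite !andbF.
rewrite !andbT andbC; case: (boolP (e \subset V)) => // eV; rewrite andTb.
have le3 : #|group_of @: e| <= 3 by rewrite -e3 leq_imset_card.
have -> : (e \in F) = (#|group_of @: e| == 1).
  apply/imsetP/cards1P=> [[i iS ->]|[i ei]]; exists i.
  - apply/setP=> j; rewrite inE; apply/imsetP/eqP=> [[y]|->]; first by rewrite !inE => /eqP<-.
    by exists (vertex (i, ord0)); rewrite ?inE /group_of vertexK.
  - have [y ye yi] : exists2 y, y \in e & i = group_of y by apply/imsetP; rewrite ei inE.
    by move/subsetP/(_ y ye): eV; rewrite inE -yi.
  apply/eqP; rewrite eqEcard card_fiber e3 leqnn andbT; apply/subsetP=> y ye.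
  by rewrite !inE -in_set1 -ei imset_f.
have : 0 < #|group_of @: e|.
  rewrite card_gt0; apply/set0Pn.
  have /card_gt0P[y ye] : 0 < #|e| by rewrite e3.
  by exists (group_of y); apply: imset_f.
by move: le3; case: #|_| => [|[|[|[]]]].
Qed.

Lemma complete_minus_fibers : #|S| %% 4 < 3 ->
  exists cs : seq {ffun 'I_6 -> T}, kcycle_decomposition (complete3 V :\: F) cs.
Proof.
move=> S3; apply: decomposition_exists complete_minus_fibersE _.
have dis : [disjoint ksubsets 2 S & ksubsets 3 S].
  by rewrite -setI_eq0; apply/eqP/setP=> s; rewrite !inE; case: (_ \subset S); case: eqP => //= ->.
have := enum_setU_disjoint dis; rewrite perm_sym => /liftable_perm; apply.
by apply: liftable_cat; [apply: liftable_ksubsets2 | apply: liftable_ksubsets3].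
Qed.

Lemma crossing_triples : #|S| = #|~: S| -> #|S| %% 4 < 3 ->
  exists cs : seq {ffun 'I_6 -> T}, kcycle_decomposition (crossing3 V (~: V)) cs.
Proof.
move=> cS S3.
pose P2 : {set {set G}} := [set s | (#|s :&: S| == 1) && (#|s :&: ~: S| == 1)].
apply: (@decomposition_exists _ (P2 :|: (two_one S (~: S) :|: two_one (~: S) S))).
  apply/setP=> e; rewrite !inE; case: eqP => //= e3.
  have meet (A : {set G}) : (e :&: group_of @^-1: A != set0) = (0 < #|group_of @: e :&: A|).
    rewrite card_gt0; apply/set0Pn/set0Pn=> [[y]|[i]].
      by rewrite !inE => /andP[ye yA]; exists (group_of y); rewrite inE imset_f.
    by rewrite inE => /andP[/imsetP[y ye ->] yA]; exists y; rewrite !inE ye.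
  have -> : ~: V = group_of @^-1: (~: S) by apply/setP=> y; rewrite !inE.
  rewrite !meet.
  have : #|group_of @: e| <= 3 by rewrite -e3 leq_imset_card.
  (* A set of at most three groups meets both sides exactly when its traces have sizes 1+1, 2+1 or
     1+2. *)
  rewrite -(cardsID S (group_of @: e)) setDE.
  by case: #|_| => [|[|[|[|?]]]]; case: #|_| => [|[|[|[|?]]]]; rewrite ?addnS.
have lP2 : liftable (enum P2).
  apply: liftable_seq => s; rewrite mem_enum inE => /andP[/eqP s1 /eqP s2].
  have /eqP/cards2P[i [j [ij ->]]] : #|s| = 2 by rewrite -(cardsID S) setDE s1 s2.
  exact: liftable_pair.
have l12 := liftable_two_one cS S3.
(* The mirror image, with [S] and its complement exchanged. *)
have := @liftable_two_one (~: S); rewrite setCK -cS => /(_ erefl S3) l21.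
have d1 : [disjoint two_one S (~: S) & two_one (~: S) S].
  by rewrite -setI_eq0; apply/eqP/setP=> s; rewrite !inE;
    case: #|s :&: S| => [|[|[]]]; rewrite ?andbF.
have d2 : [disjoint P2 & two_one S (~: S) :|: two_one (~: S) S].
  rewrite -setI_eq0; apply/eqP/setP=> s; rewrite !inE.
  by case: #|s :&: S| => [|[|[]]] //=; case: #|_| => [|[|[]]].
have := enum_setU_disjoint d2; rewrite perm_sym => /liftable_perm; apply.
apply: liftable_cat => //.
have := enum_setU_disjoint d1; rewrite perm_sym => /liftable_perm; apply.
exact: liftable_cat.
Qed.

End Side.

End Groups.

(** * Assembly on [v] vertices *)

Theorem theorem17 (v : nat) :
  12 <= v -> v %% 24 \in [:: 0; 6; 12] -> two_split_decomposition v 6.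
Proof.
move=> _ vmod.
(* The residues 0, 6, 12 modulo 24 are those of 6m with m = 0, 1, 2 modulo 4. *)
have [m vE m3] : exists2 m, v = 6 * m & m %% 4 < 3.
  exists (v %/ 6); move: vmod; rewrite !inE; lia.
(* The boolean names the side; any bijection of the 6m points with ['I_v] serves, here the one given
   by [enum_rank]. *)
pose G := ('I_m * bool)%type.
have cardE_ : #|{: G * 'I_3}| = v by rewrite !card_prod !card_ord card_bool vE; lia.
pose vertex (p : G * 'I_3) : 'I_v := cast_ord cardE_ (enum_rank p).
pose coord (x : 'I_v) : G * 'I_3 := enum_val (cast_ord (esym cardE_) x).
have coordK : cancel coord vertex by move=> x; rewrite /vertex /coord enum_valK cast_ordKV.
have vertexK : cancel vertex coord by move=> p; rewrite /vertex /coord cast_ordK enum_rankK.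
pose S b : {set G} := [set p | p.2 == b].
have cardS b : #|S b| = m.
  have -> : S b = setX [set: 'I_m] [set b] by apply/setP=> -[i c]; rewrite !inE.
  by rewrite cardsX cardsT card_ord cards1 muln1.
have SC : ~: S false = S true by apply/setP=> -[i []]; rewrite !inE.
have cardV b : #|group_of coord @^-1: S b| = v %/ 2.
  have -> : group_of coord @^-1: S b = coord @^-1: setX (S b) [set: 'I_3].
    by apply/setP=> x; rewrite !inE andbT.
  rewrite on_card_preimset; last by exists vertex => x _; [apply: coordK | apply: vertexK].
  by rewrite cardsX cardS cardsT card_ord vE; lia.
have S3 b : #|S b| %% 4 < 3 by rewrite cardS.
have [cs1 dec1] := complete_minus_fibers coordK vertexK (S3 false).
have [cs2 dec2] := complete_minus_fibers coordK vertexK (S3 true).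
have [|cs3 dec3] := crossing_triples coordK vertexK _ (S3 false).
  by rewrite SC !cardS.
exists (group_of coord @^-1: S false), [set group_of coord @^-1: [set i] | i in S false],
  [set group_of coord @^-1: [set i] | i in S true], cs1, cs2, cs3.
have VC : ~: (group_of coord @^-1: S false) = group_of coord @^-1: S true.
  by rewrite -preimsetC SC.
rewrite VC in dec3; rewrite /= VC; split; split; rewrite ?cardV //;
  exact: (fibers_one_factor coordK vertexK).
Qed.
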